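(* Let $G$ be a directed graph, $R$ a set of vertices of $G$, and $F, F'$ two $R$-directed forests in $G$ with $|F|=|F'|=k$. Then there is a sequence $\langle F=F_0, F_1, \ldots, F_\ell=F'\rangle$ of $R$-directed forests in $G$ such that $|A(F_i)\setminus A(F_{i+1})| = |A(F_{i+1})\setminus A(F_i)|=1$ for all $0\le i<\ell$, and $\ell\le k$.
   Context: A directed tree is a directed graph whose underlying undirected graph is a tree and in which every vertex except one vertex (the root) has in-degree exactly $1$. A directed forest is a disjoint union of directed trees; it is called an $R$-directed forest if $R$ is the set of roots of its weakly connected components. $|F|$ denotes the number of arcs of $F$. *)

(* Defs.v *)
From mathcomp Require Import all_boot.

Set Implicit Arguments.
Unset Strict Implicit.
Unset Printing Implicit Defensive.

(* Finite directed graphs; loops and parallel arcs are allowed.  Simple digraphs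
   are the case where [a |-> (src a, tgt a)] is injective. *)
Record digraph := Digraph {
  vertex : finType;
  arc : finType;
  src : arc -> vertex;
  tgt : arc -> vertex
}.

Arguments src {d} a.
Arguments tgt {d} a.

Record subgraph (G : digraph) := Subgraph {
  verts : {set vertex G};
  arcs : {set arc G};
  arcs_closed : [forall a in arcs, (src a \in verts) && (tgt a \in verts)]
}.

Section Defs.

Variable G : digraph.
Implicit Types (H : subgraph G) (R : {set vertex G}).

Definition indeg H (v : vertex G) : nat := #|[set a in arcs H | tgt a == v]|.

Definition wadj H : rel (vertex G) := fun u v =>
  [exists a in arcs H, ((src a == u) && (tgt a == v))
                    || ((src a == v) && (tgt a == u))].

Definition weakly_connected H : Prop :=
  verts H != set0 /\ {in verts H &, forall u v, connect (wadj H) u v}.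

(* A step of a walk in the underlying undirected graph: an arc together with the
   sense in which it is traversed ([true] = from source to target). *)
Definition step_from (s : arc G * bool) : vertex G :=
  if s.2 then src s.1 else tgt s.1.
Definition step_to (s : arc G * bool) : vertex G :=
  if s.2 then tgt s.1 else src s.1.

(* Cycles of the underlying undirected multigraph: a loop is a cycle of length 1,
   and two parallel or antiparallel arcs form a cycle of length 2. *)
Definition undirected_cycle H (c : seq (arc G * bool)) : bool :=
  [&& c != [::],
      all (fun s => s.1 \in arcs H) c,
      cycle (fun s t => step_to s == step_from t) c,
      uniq [seq s.1 | s <- c]
    & uniq [seq step_from s | s <- c]].

Definition underlying_tree H : Prop :=
  weakly_connected H /\ forall c, ~~ undirected_cycle H c.

Definition directed_tree_rooted_at H (r : vertex G) : Prop :=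
  [/\ underlying_tree H,
      r \in verts H
    & {in verts H, forall v, (indeg H v == 1) = (v != r)}].

Definition directed_tree H : Prop := exists r, directed_tree_rooted_at H r.

Definition directed_forest H : Prop :=
  exists (I : finType) (T : I -> subgraph G),
    [/\ forall i, directed_tree (T i),
        forall i j, i != j -> [disjoint verts (T i) & verts (T j)],
        verts H = \bigcup_i verts (T i)
      & arcs H = \bigcup_i arcs (T i)].

Lemma induced_closed H (C : {set vertex G}) :
  [forall a in [set a in arcs H | (src a \in C) && (tgt a \in C)],
     (src a \in C) && (tgt a \in C)].
Proof. by apply/forall_inP => a; rewrite inE => /andP[]. Qed.

(* The weakly connected component of [x], for [x \in verts H]. *)
Definition weak_component H (x : vertex G) : subgraph G :=
  Subgraph (induced_closed H [set v | connect (wadj H) x v]).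

Definition R_directed_forest R H : Prop :=
  directed_forest H /\
  forall r, r \in R <->
    exists2 x, x \in verts H & directed_tree_rooted_at (weak_component H x) r.

End Defs.

(* Main.v *)
(** A branching is a set of arcs that can be grown from [R] one arc at a time,
    each new arc leading from a vertex already reached to a new one; the
    R-directed forests are exactly the subgraphs whose arcs form a branching and
    whose vertices are those reached.

    To transform [F] into [F'], maintain a branching [C] contained in both.  As
    long as [C] is not all of [F'], some arc [a] of [F'] outside [C] starts at a
    vertex reached by [C].  If the target of [a] is reached by [F], let [a]
    replace the arc of [F] with the same target; otherwise add [a] and delete an
    arc of [F] outside [C] whose target is a leaf.  Either way [C] gains [a], so
    at most [k] steps are needed. *)

Require Import Defs.
From mathcomp Require Import all_boot.

Set Implicit Arguments.
Unset Strict Implicit.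
Unset Printing Implicit Defensive.

(** * Auxiliary facts on reachability, injectivity and iterated maps *)

Lemma connect_stable (T : finType) (e : rel T) (P : T -> Prop) x y :
  connect e x y -> P x -> (forall u v, P u -> e u v -> P v) -> P y.
Proof.
case/connectP=> p + -> + Pe.
by elim: p x => [|z p IHp] x //= /andP[xz zp] Px; apply: IHp zp (Pe _ _ Px xz).
Qed.

Lemma uniq_map_inj (T1 T2 : eqType) (f : T1 -> T2) s :
  uniq [seq f x | x <- s] -> {in s &, injective f}.
Proof.
elim: s => [|z s IH] //= /andP[zs us] x y.
rewrite !inE => /predU1P[->|xs] /predU1P[->|ys] // e; last exact: IH.
  by rewrite e map_f in zs.
by rewrite -e map_f in zs.
Qed.

(** Choose [x] in [S] of minimal [order]: if its orbit were not a cycle, [f x] would be an element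
    of [S] with an orbit shorter by one. *)
Lemma fcycle_orbit_exists (T : finType) (f : T -> T) (S : {set T}) :
    S != set0 -> {homo f : x / x \in S} ->
  exists x, fcycle f (orbit f x) /\ {subset orbit f x <= S}.
Proof.
case/set0Pn=> x0 x0S fS.
have [x xS min_x] := @arg_minnP _ x0 (mem S) (order f) x0S.
exists x; split.
  by case: orderPcycle => // _ e; have := min_x _ (fS _ xS); rewrite e ltnn.
by move=> _ /trajectP[i _ ->]; elim: i => //= i IH; apply: fS.
Qed.

(** * Branchings and their growth order *)

Section Branching.

Variables (G : digraph) (R : {set vertex G}).
Implicit Types (A B C D : {set Defs.arc G}) (a b : Defs.arc G) (H : subgraph G).

(** The vertices reached from [R], expressed without walks; this reading is justified when [A] is a
    branching. *)
Definition spanned A : {set vertex G} := R :|: [set tgt a | a in A].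

Inductive branching : {set Defs.arc G} -> Prop :=
| branching0 : branching set0
| branchingU A a : branching A -> src a \in spanned A -> tgt a \notin spanned A ->
    branching (a |: A).

Lemma spannedP A v :
  reflect (v \in R \/ exists2 a, a \in A & v = tgt a) (v \in spanned A).
Proof.
rewrite in_setU; apply: (iffP orP) => -[vR|vA]; try by left.
  by right; apply/imsetP.
by right; apply/imsetP.
Qed.

Lemma tgt_spanned A a : a \in A -> tgt a \in spanned A.
Proof. by move=> aA; apply/spannedP; right; exists a. Qed.

Lemma spanned_sub A B : A \subset B -> spanned A \subset spanned B.
Proof. by move=> sAB; rewrite setUS // imsetS. Qed.

Lemma branching_src A a : branching A -> a \in A -> src a \in spanned A.
Proof.
elim=> [|B b _ IH sb tb]; first by rewrite inE.
have sub : spanned B \subset spanned (b |: B) by rewrite spanned_sub // subsetUr.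
by rewrite in_setU1 => /predU1P[->|aB]; apply: (subsetP sub) => //; apply: IH.
Qed.

Lemma branching_tgtNR A a : branching A -> a \in A -> tgt a \notin R.
Proof.
elim=> [|B b _ IH sb tb]; first by rewrite inE.
rewrite in_setU1 => /predU1P[->|]; last exact: IH.
by apply: contra tb => tR; apply/spannedP; left.
Qed.

Lemma branching_tgt_inj A : branching A -> {in A &, injective tgt}.
Proof.
elim=> [|B b _ IH sb tb] x y; first by rewrite inE.
rewrite !in_setU1 => /predU1P[->|xB] /predU1P[->|yB] // e; last exact: IH.
  by rewrite e tgt_spanned in tb.
by rewrite -e tgt_spanned in tb.
Qed.

Lemma branching_new_tgt A C a : branching A -> C \subset A -> a \in A ->
  a \notin C -> tgt a \notin spanned C.
Proof.
move=> brA sCA aA; apply: contra => /spannedP[tR|[b bC e]].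
  by have := branching_tgtNR brA aA; rewrite tR.
by rewrite (branching_tgt_inj brA aA (subsetP sCA b bC) e).
Qed.

(** Take the first arc outside [C] in a growth order of [A]: all earlier arcs lie in [C], so its
    source is reached by [C]. *)
Lemma branching_frontier A C : branching A -> ~~ (A \subset C) ->
  exists a, [/\ a \in A, a \notin C & src a \in spanned C].
Proof.
elim=> [|B b _ IH sb _]; first by rewrite sub0set.
case: (boolP (B \subset C)) => [sBC|nBC _]; last first.
  by have [a [aB aC sa]] := IH nBC; exists a; rewrite in_setU1 aB orbT.
rewrite subUset sBC andbT sub1set => bC.
by exists b; rewrite setU11 bC (subsetP (spanned_sub sBC)).
Qed.

(** Take the last arc of [D] in a growth order of [A]: its target is new when it is added, whereas
    its own source and those of all earlier arcs were reached before. *)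
Lemma branching_leaf A D : branching A -> D \subset A -> D != set0 ->
  exists2 a, a \in D & {in D, forall b, src b != tgt a}.
Proof.
elim=> [|B a brB IH sa ta] sD D0; first by rewrite subset0 (negPf D0) in sD.
have [aD|aD] := boolP (a \in D); last first.
  apply: IH => //; apply/subsetP=> b bD; have := subsetP sD b bD.
  by rewrite in_setU1 => /predU1P[e|//]; rewrite -e bD in aD.
exists a => // b /(subsetP sD); rewrite in_setU1 => /predU1P[->|bB].
  by apply: contraNneq ta => <-.
by apply: contraNneq ta => <-; apply: branching_src.
Qed.

(** No arc of [A] starts at the target of [a], so a growth order of [A] remains one when [a] is
    skipped. *)
Lemma branching_del_leaf A a : branching A -> a \in A ->
  {in A, forall b, src b != tgt a} -> branching (A :\ a).
Proof.
elim=> [|B b brB IH sb tb]; first by rewrite inE.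
have bB : b \notin B by apply: contra tb; apply: tgt_spanned.
move=> aA leaf; have [ab|nab] := eqVneq a b; first by rewrite ab setU1K.
have aB : a \in B by move: aA; rewrite in_setU1 (negPf nab).
have -> : (b |: B) :\ a = b |: B :\ a.
  by apply/setP=> c; rewrite !inE; case: (eqVneq c a) => // ->; rewrite (negPf nab).
apply: branchingU.
- by apply: IH => // c cB; apply: leaf; rewrite in_setU1 cB orbT.
- case/spannedP: sb => [sR|[c cB e]]; apply/spannedP; [by left|right; exists c] => //.
  rewrite in_setD1 cB andbT; apply: contraNneq (leaf _ (setU11 b B)) => <-.
  by rewrite e.
- by apply: contra tb; apply/subsetP/spanned_sub/subD1set.
Qed.

(* The arcs of [A] entering vertices reached by [C] are discarded, so that [C]
   takes precedence over [A]. *)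
Lemma branching_override C A : branching C -> branching A ->
  branching (C :|: [set a in A | tgt a \notin spanned C]).
Proof.
move=> brC; set f := fun A => C :|: [set a in A | tgt a \notin spanned C].
have fE B a : (a \in f B) = (a \in C) || (a \in B) && (tgt a \notin spanned C).
  by rewrite in_setU in_set.
(* Discarding arcs loses no vertex, since the target of a discarded arc is reached by [C]. *)
have fS B v : v \in spanned B -> v \in spanned (f B).
  case/spannedP=> [vR|[a aB ->]]; first by apply/spannedP; left.
  have [tC|tC] := boolP (tgt a \in spanned C).
    by apply: subsetP tC; rewrite spanned_sub // subsetUl.
  by apply: tgt_spanned; rewrite fE aB tC orbT.
elim=> [|B b brB IH sb tb]; rewrite -/(f _).
  by rewrite (_ : f _ = C) //; apply/setP=> a; rewrite fE in_set0 orbF.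
have [tC|tC] := boolP (tgt b \in spanned C).
  rewrite (_ : f _ = f B) //; apply/setP=> a; rewrite !fE in_setU1.
  by case: eqVneq => [->|//] /=; rewrite tC andbF orbF.
have -> : f (b |: B) = b |: f B.
  apply/setP=> a; rewrite in_setU1 !fE in_setU1.
  by case: eqVneq => [->|//] /=; rewrite tC orbT.
apply: branchingU => //; first exact: fS.
apply/negP=> /spannedP[tR|[a + e]].
  by move/spannedP: tb; apply; left.
rewrite fE => /orP[aC|/andP[aB _]].
  by rewrite e tgt_spanned in tC.
by rewrite e tgt_spanned in tb.
Qed.

(** * The exchange step *)

(** The case [B = A] occurs when [a] is already in [A]: the common part [C] grows while the
    branching stays the same. *)
Lemma branching_exchange A A' C : branching A -> branching A' -> branching C ->
    C \subset A -> C \subset A' -> #|A| = #|A'| -> ~~ (A' \subset C) ->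
  exists B a, [/\ a \in A', a \notin C, branching B,
    branching (a |: C) /\ a |: C \subset B
    & B = A \/ exists b, [/\ a \notin A, b \in A & B = a |: A :\ b]].
Proof.
move=> brA brA' brC sCA sCA' eqA nA'C.
have [a [aA' aC sa]] := branching_frontier brA' nA'C.
have ta := branching_new_tgt brA' sCA' aA' aC.
have braC : branching (a |: C) by apply: branchingU.
have [aA|aA] := boolP (a \in A).
  by exists A, a; split=> //; [split=> //; rewrite subUset sub1set aA | left].
have [b [bA bC brB]] :
    exists b, [/\ b \in A, b \notin C & branching (a |: A :\ b)].
  case: (boolP (tgt a \in spanned A)) => [/spannedP[tR|[b bA e]]|tA].
  - by have := branching_tgtNR brA' aA'; rewrite tR.
  - have bC : b \notin C by apply: contra ta; rewrite e; apply: tgt_spanned.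
    exists b; split=> //.
    (* The only arc of [A] outside [C] that enters a vertex reached by [a |: C] is [b], so swapping
       [b] for [a] amounts to giving [a |: C] precedence over [A]. *)
    rewrite (_ : a |: _ = (a |: C) :|: [set c in A | tgt c \notin spanned (a |: C)]).
      exact: branching_override.
    apply/setP=> c; rewrite in_setU1 in_setD1 in_setU in_setU1 in_set.
    have [//|nca] := eqVneq c a; have [cC|cC] := boolP (c \in C).
      by rewrite (subsetP sCA) // andbT /=; apply: contraNneq bC => <-.
    have [cA|] := boolP (c \in A); last by rewrite andbF.
    rewrite andbT /=; apply/idP/idP; last first.
      by apply: contra => /eqP->; rewrite -e tgt_spanned // setU11.
    apply: contra => /spannedP[cR|[d]].
      by have := branching_tgtNR brA cA; rewrite cR.
    rewrite in_setU1 => /predU1P[->|dC] ecd.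
      by rewrite (branching_tgt_inj brA cA bA) // ecd.
    by rewrite (branching_tgt_inj brA cA (subsetP sCA d dC) ecd) dC in cC.
  - have brAa : branching (a |: A).
      by apply: branchingU => //; apply: subsetP sa; rewrite spanned_sub.
    (* This is where equal cardinality enters: if [C] were all of [A], it would be all of [A']
       too. *)
    have nAC : A :\: C != set0.
      rewrite setD_eq0; apply: contra nA'C => sAC.
      have eC : C = A by apply/eqP; rewrite eqEsubset sCA.
      have /eqP eC' : C == A' by rewrite eqEcard sCA' -eqA eC leqnn.
      by rewrite eC'.
    have [b bAC leaf] := branching_leaf brA (subsetDl A C) nAC.
    move: (bAC); rewrite in_setD => /andP[bC bA].
    have tb := branching_new_tgt brA sCA bA bC.
    have nab : a != b by apply: contraNneq aA => ->.
    exists b; split=> //.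
    have -> : a |: A :\ b = (a |: A) :\ b.
      by apply/setP=> c; rewrite !inE; case: (eqVneq c a) => // ->; rewrite nab.
    (* The target of [b] is a leaf of all of [a |: A]: [a] and the arcs of [C] start at vertices
       reached by [C], which the target of [b] is not, and the other arcs are handled by the choice
       of [b]. *)
    apply: branching_del_leaf; rewrite ?in_setU1 ?bA ?orbT // => c.
    rewrite in_setU1 => /predU1P[->|cA].
      by apply: contraNneq tb => <-.
    have [cC|cC] := boolP (c \in C); last by apply: leaf; rewrite in_setD cC.
    by apply: contraNneq tb => <-; apply: branching_src.
exists (a |: A :\ b), a; split=> //; last by right; exists b.
split=> //; rewrite setUS //; apply/subsetP=> c cC.
by rewrite in_setD1 (subsetP sCA) // andbT; apply: contraNneq bC => <-.
Qed.

(** * Acyclicity and components of a branching *)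

Lemma branching_closed A : branching A ->
  [forall a in A, (src a \in spanned A) && (tgt a \in spanned A)].
Proof.
by move=> brA; apply/forall_inP=> a aA; rewrite branching_src ?tgt_spanned.
Qed.

(** The newest arc [a] is no loop and is the only arc at its target. A closed walk through [a] has
    an adjacent step at that target, which must again use [a]; as arcs do not repeat, this step is
    the same one, so [a] would be a loop. Hence the walk avoids [a], and induction applies. *)
Lemma branching_acyclic A c : branching A -> c != [::] ->
  all (fun s => s.1 \in A) c -> cycle (fun s t => step_to s == step_from t) c ->
  uniq [seq s.1 | s <- c] -> False.
Proof.
move=> brA c0 cA cyc /[dup] /map_uniq cu u.
elim: A / brA cA => [|A a brA IH sa ta] /allP cA.
  by case: c c0 cA {cyc cu u} => // s c _ /(_ s (mem_head _ _)); rewrite inE.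
have end_a s : s \in c -> (src s.1 == tgt a) || (tgt s.1 == tgt a) -> s.1 = a.
  move/cA; rewrite in_setU1 => /predU1P[//|sA] /orP[] /eqP e.
    by rewrite -e branching_src in ta.
  by rewrite -e tgt_spanned in ta.
have inj_arc s t : s \in c -> t \in c -> s.1 = t.1 -> s = t.
  by move=> sc tc e; apply: uniq_map_inj u _ _ _ _ e.
have loop s : s \in c -> s.1 = a -> step_to s = step_from s -> False.
  move=> _ e; rewrite /step_to /step_from e.
  by case: s.2 => e'; move: ta sa; rewrite -?e' ?e' => /negPf->.
apply: IH; apply/allP=> s sc; have := cA s sc; rewrite in_setU1 => /predU1P[e|//].
case: (loop s sc e); case es: s.2.
  have nc : next c s \in c by rewrite mem_next.
  have /eqP et := next_cycle cyc sc.
  rewrite {1}et; congr step_from; apply: inj_arc => //; rewrite e; apply: end_a => //.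
  move: et; rewrite /step_to es e /step_from; case: ifP => _ ->; rewrite eqxx ?orbT //.
have pc : prev c s \in c by rewrite mem_prev.
have /eqP et := prev_cycle cyc sc.
rewrite -et; congr step_to; symmetry; apply: inj_arc => //; rewrite e; apply: end_a => //.
move: et; rewrite /step_from es e /step_to; case: ifP => _ <-; rewrite eqxx ?orbT //.
Qed.

(** Here [rho] assigns to a reached vertex the root of its component. Being constant along arcs, it
    keeps distinct roots in distinct weak components. *)
Lemma branching_root A : branching A -> exists rho : vertex G -> vertex G,
  {in R, forall r, rho r = r} /\ {in A, forall a, rho (src a) = rho (tgt a)}.
Proof.
elim=> [|{}A a brA [rho [rhoR rhoA]] sa ta].
  by exists id; split=> // a; rewrite inE.
exists (fun v => if v == tgt a then rho (src a) else rho v); split=> [r rR|b].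
  by rewrite ifN ?rhoR //; apply: contraNneq ta => <-; apply/spannedP; left.
rewrite in_setU1 => /predU1P[->|bA].
  by rewrite eqxx; case: eqP.
rewrite !ifN ?rhoA //; apply: contraNneq ta => <-; first exact: tgt_spanned.
exact: branching_src.
Qed.

Lemma branching_connect (e : rel (vertex G)) A v : branching A ->
    {in A, forall a, e (src a) (tgt a)} -> v \in spanned A ->
  exists2 r, r \in R & connect e r v.
Proof.
move=> brA; elim: brA v => [|{}A a _ IH sa _] v eA vA.
  case/spannedP: vA => [vR|[a]]; [by exists v | by rewrite inE].
have {}IH u := IH u (fun b bA => eA b (setU1r a bA)).
case/spannedP: vA => [vR|[b + ->]]; first by exists v.
rewrite in_setU1 => /predU1P[->|/tgt_spanned/IH//].
have [r rR ra] := IH _ sa; exists r => //.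
exact: connect_trans ra (connect1 (eA _ (setU11 a A))).
Qed.


(** * Recognising branchings by in-degrees and acyclicity *)

(** Otherwise every vertex of [S] has an entering arc from [S]. Following chosen arcs backwards maps
    [S] to itself, and a periodic orbit of this map is an undirected cycle. *)
Lemma acyclic_no_backward_closed H (S : {set vertex G}) :
    (forall c, ~~ undirected_cycle H c) -> S != set0 ->
  exists2 v, v \in S & {in arcs H, forall a, tgt a = v -> src a \notin S}.
Proof.
move=> acyc S0; have [/exists_inP[v vS vP]|] := boolP [exists v in S,
    [forall a in arcs H, (tgt a == v) ==> (src a \notin S)]].
  exists v => // a aH ea; have := forall_inP vP a aH.
  by rewrite ea eqxx.
rewrite negb_exists_in => /forall_inP closedS.
have {}closedS v : v \in S -> exists a,
    [&& a \in arcs H, tgt a == v & src a \in S].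
  move/closedS; rewrite negb_forall_in => /exists_inP[a aH].
  by rewrite negb_imply negbK => aP; exists a; rewrite aH.
have [a0 _] : exists a0 : Defs.arc G, true.
  by case/set0Pn: S0 => v /closedS[a _]; exists a.
(* The default [a0] only makes [g] total; on [S] the choice always succeeds. *)
pose g v := odflt a0 [pick a | [&& a \in arcs H, tgt a == v & src a \in S]].
have gP v : v \in S -> [/\ g v \in arcs H, tgt (g v) = v & src (g v) \in S].
  rewrite /g => vS; case: pickP => [a /and3P[? /eqP ? ?] //|no].
  by have [a] := closedS v vS; rewrite no.
have [x [cyc sub]] := @fcycle_orbit_exists _ (src \o g) S S0
  (fun v vS => let: And3 _ _ h := gP v vS in h).
have gK : {in orbit (src \o g) x, cancel g tgt} by move=> v /sub/gP[].
set o := orbit _ x in cyc sub gK.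
(* Each arc is traversed against its direction, hence [false]. The arcs are distinct because their
   targets are the distinct vertices of the orbit. *)
have /negP[] := acyc [seq (g v, false) | v <- o].
apply/and5P; split.
- by rewrite -size_eq0 size_map -lt0n; case: (o) (in_orbit (src \o g) x : x \in o).
- by rewrite all_map; apply/allP=> v /sub/gP[].
- rewrite cycle_map; apply: (sub_in_cycle (P := mem o)) cyc; last exact/allP.
  by move=> u v _ vo; rewrite /= /step_to /step_from /= gK.
- rewrite -map_comp map_inj_in_uniq ?orbit_uniq //.
  exact: can_in_inj gK.
- by rewrite -map_comp (@eq_in_map _ _ _ id o).1 ?map_id ?orbit_uniq.
Qed.

(** A branching [B] inside [A] that misses an arc can be extended: the unreached part of [V] is
    nonempty, so it has a vertex whose entering arc starts outside that part, hence at a reached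
    vertex. *)
Lemma branching_of_indeg A (V : {set vertex G}) :
    {in A &, injective tgt} -> {in A, forall a, tgt a \in V :\: R} ->
    {in A, forall a, src a \in V} ->
    {in V :\: R, forall v, exists2 a, a \in A & tgt a = v} ->
    (forall S, S != set0 -> S \subset V ->
      exists2 v, v \in S & {in A, forall a, tgt a = v -> src a \notin S}) ->
  branching A.
Proof.
move=> injA tgtA srcA inA wfA.
suff ext n B : #|A :\: B| <= n -> B \subset A -> branching B -> branching A.
  exact: ext (leqnn _) (sub0set _) branching0.
elim: n B => [|n IH] B.
  rewrite leqn0 cards_eq0 setD_eq0 => sAB sBA.
  by rewrite (_ : A = B) //; apply/eqP; rewrite eqEsubset sAB.
move=> leAB sBA brB; have [sAB|/subsetPn[a aA aB]] := boolP (A \subset B).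
  by rewrite (_ : A = B) //; apply/eqP; rewrite eqEsubset sAB.
have tB c : c \in A -> c \notin B -> tgt c \notin spanned B.
  move=> cA; apply: contra => /spannedP[cR|[b bB /injA->//]].
    by have := tgtA c cA; rewrite in_setD cR.
  exact: (subsetP sBA).
have [v] : exists2 v, v \in V :\: spanned B &
    {in A, forall a, tgt a = v -> src a \notin V :\: spanned B}.
  apply: wfA; last exact: subsetDl.
  apply/set0Pn; exists (tgt a); rewrite in_setD tB //.
  by have := tgtA a aA; rewrite in_setD => /andP[].
rewrite in_setD => /andP[vB vV] vP.
have [|b bA eb] := inA v.
  by rewrite in_setD vV andbT; apply: contra vB => vR; apply/spannedP; left.
have bB : b \notin B by apply: contra vB => bB; rewrite -eb tgt_spanned.
have sb : src b \in spanned B.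
  by have := vP b bA eb; rewrite in_setD srcA // andbT negbK.
apply: (IH (b |: B)).
- rewrite setUC -setDDl -ltnS (leq_trans _ leAB) // [ltnRHS](cardsD1 b).
  by rewrite in_setD bB bA.
- by rewrite subUset sub1set bA.
- by apply: branchingU => //; apply: tB.
Qed.

End Branching.

(** * Directed forests correspond to branchings *)

Section Forests.

Variables (G : digraph) (R : {set vertex G}).
Implicit Type H : subgraph G.

Lemma subgraph_eq H H' : verts H = verts H' -> arcs H = arcs H' -> H = H'.
Proof.
case: H H' => [V A c] [V' A' c'] /= eV eA; subst V' A'.
by congr Subgraph; apply: bool_irrelevance.
Qed.

Lemma arc_verts H a : a \in arcs H -> src a \in verts H /\ tgt a \in verts H.
Proof. by move=> aH; have /andP := forall_inP (arcs_closed H) a aH. Qed.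

Lemma wadjP H u v : reflect
  (exists2 a, a \in arcs H & (src a = u /\ tgt a = v) \/ (src a = v /\ tgt a = u))
  (wadj H u v).
Proof.
apply: (iffP exists_inP) => -[a aH e]; exists a => //.
  by case/orP: e => /andP[/eqP ? /eqP ?]; [left|right].
by case: e => -[-> ->]; rewrite !eqxx ?orbT.
Qed.

Lemma wadj_arc H a : a \in arcs H -> wadj H (src a) (tgt a).
Proof. by move=> aH; apply/wadjP; exists a => //; left. Qed.

Lemma wadj_sym H : symmetric (wadj H).
Proof.
by move=> u v; apply/wadjP/wadjP => -[a aH e]; exists a => //; case: e; [right|left|right|left].
Qed.

(** The definition only says that the in-degree of the root is not 1. If it were positive, every
    vertex would have an entering arc, against acyclicity. *)
Lemma tree_root_no_in H r :
  directed_tree_rooted_at H r -> {in arcs H, forall a, tgt a != r}.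
Proof.
case=> -[_ acyc] rH indegH a aH; apply/eqP=> ar.
have [|v vH vP] := @acyclic_no_backward_closed _ H (verts H) acyc.
  by apply/set0Pn; exists r.
have [b bH bv] : exists2 b, b \in arcs H & tgt b = v.
  have [->|nvr] := eqVneq v r; first by exists a.
  have /cards1P[b eb] : indeg H v == 1 by rewrite indegH.
  by have := set11 b; rewrite -eb inE => /andP[bH /eqP]; exists b.
by have := vP b bH bv; rewrite (arc_verts bH).1.
Qed.

(** By disjointness the trees [T i] are exactly the weak components of [H], so their roots form [R];
    in-degrees and acyclicity are then read off tree by tree. *)
Lemma branching_of_forest H : R_directed_forest R H ->
  branching R (arcs H) /\ verts H = spanned R (arcs H).
Proof.
case=> -[I [T [treeT disT vT aT]]] RT.
have TofV v : v \in verts H -> exists i, v \in verts (T i).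
  by rewrite vT => /bigcupP[i]; exists i.
have sVT i v : v \in verts (T i) -> v \in verts H.
  by move=> vi; rewrite vT; apply/bigcupP; exists i.
have sAT i a : a \in arcs (T i) -> a \in arcs H.
  by move=> ai; rewrite aT; apply/bigcupP; exists i.
have arcT i a : a \in arcs H ->
    (src a \in verts (T i)) || (tgt a \in verts (T i)) -> a \in arcs (T i).
  rewrite aT => /bigcupP[j _ aj].
  have [->//|nij] := eqVneq i j; have dij := disjointFl (disT _ _ nij).
  by have [sj tj] := arc_verts aj; rewrite !dij.
have compT i x : x \in verts (T i) -> weak_component H x = T i.
  move=> xi; have [r [[[_ conT] _] _ _]] := treeT i.
  have eV : verts (weak_component H x) = verts (T i).
    apply/setP=> v; rewrite inE; apply/idP/idP => [xv|vi].
      apply: (connect_stable (P := fun v => v \in verts (T i)) xv xi).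
      move=> u w ui /wadjP[a aH [] [su tw]].
        have /arc_verts[] : a \in arcs (T i) by apply: arcT; rewrite // su ui.
        by rewrite tw.
      have /arc_verts[] : a \in arcs (T i) by apply: arcT; rewrite // tw ui orbT.
      by rewrite su.
    apply: connect_sub (conT _ _ xi vi) => u w /wadjP[a /sAT aH e].
    by apply/connect1/wadjP; exists a.
  apply: subgraph_eq => //; apply/setP=> a; rewrite inE.
  rewrite -[[set _ | _]]/(verts (weak_component H x)) eV.
  apply/and3P/idP => [[aH si _]|ai]; first by apply: arcT; rewrite // si.
  by have [? ?] := arc_verts ai; split=> //; apply: sAT ai.
have rootR i r : directed_tree_rooted_at (T i) r -> r \in R.
  by move=> Tr; have [_ ri _] := Tr; apply/RT; exists r; rewrite ?(compT i) ?(sVT i).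
have noin r a : r \in R -> a \in arcs H -> tgt a != r.
  case/RT=> x /TofV[i xi]; rewrite (compT i x xi) => Tr aH; apply/eqP=> ar.
  have ai : a \in arcs (T i) by apply: arcT => //; have [_ ri _] := Tr; rewrite ar ri orbT.
  by move: (tree_root_no_in Tr ai); rewrite ar eqxx.
have indegT i v : v \in verts (T i) -> v \notin R -> indeg (T i) v == 1.
  move=> vi vR; have [r Tr] := treeT i; have [_ _ ->//] := Tr.
  by apply: contraNneq vR => ->; apply: rootR Tr.
have tgtR a : a \in arcs H -> tgt a \notin R.
  by move=> aH; apply/negP=> /noin/(_ aH); rewrite eqxx.
have inH v : v \in verts H :\: R -> exists2 a, a \in arcs H & tgt a = v.
  rewrite in_setD => /andP[vR /TofV[i vi]].
  have /cards1P[a ea] := indegT i v vi vR.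
  by have := set11 a; rewrite -ea inE => /andP[/sAT aH /eqP]; exists a.
split.
  apply: (@branching_of_indeg _ R _ (verts H)) => //.
  - move=> a b aH bH e; have [i ti] := TofV _ (arc_verts aH).2.
    have /cards1P[c ec] := indegT i _ ti (tgtR a aH).
    have /set1P-> : a \in [set c] by rewrite -ec inE eqxx arcT // ti orbT.
    have /set1P-> // : b \in [set c] by rewrite -ec inE e eqxx arcT // -e ti orbT.
  - by move=> a aH; rewrite in_setD tgtR // (arc_verts aH).2.
  - by move=> a aH; case: (arc_verts aH).
  (* It suffices to look inside one tree meeting [S], because arcs entering a vertex of a tree
     belong to that tree. *)
  move=> S /set0Pn[x xS] sS; have [i xi] := TofV x (subsetP sS x xS).
  have [r [[_ acyc] _ _]] := treeT i.
  have [|v] := @acyclic_no_backward_closed _ (T i) (S :&: verts (T i)) acyc.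
    by apply/set0Pn; exists x; rewrite inE xS.
  rewrite in_setI => /andP[vS vi] vP; exists v => // a aH av.
  have ai : a \in arcs (T i) by apply: arcT; rewrite // av vi orbT.
  by have := vP a ai av; rewrite in_setI (arc_verts ai).1 andbT.
apply/setP=> v; apply/idP/spannedP => [vH|[/RT[x /TofV[i xi]]|[a aH ->]]].
- have [vR|vR] := boolP (v \in R); first by left.
  by have [|a aH av] := inH v; [rewrite in_setD vR | right; exists a].
- by rewrite (compT i x xi) => -[_ /sVT].
- by case: (arc_verts aH).
Qed.

Lemma forest_of_branching H : branching R (arcs H) ->
  verts H = spanned R (arcs H) -> R_directed_forest R H.
Proof.
move=> brH vH.
have symH : connect_sym (wadj H) by apply/sym_connect_sym/wadj_sym.
have RH r : r \in R -> r \in verts H.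
  by move=> rR; rewrite vH; apply/spannedP; left.
have rootH v : v \in verts H -> exists2 r, r \in R & connect (wadj H) r v.
  rewrite vH; apply: branching_connect brH _ => a; exact: wadj_arc.
have [rho [rhoR rhoH]] := branching_root brH.
have rho_connect u v : connect (wadj H) u v -> rho u = rho v.
  move=> uv; apply: (connect_stable (P := fun v => rho u = rho v)) uv _ _ => // x y ->.
  by case/wadjP=> a /rhoH e [] [<- <-].
have root_uniq r s : r \in R -> s \in R -> connect (wadj H) r s -> r = s.
  by move=> rR sR /rho_connect; rewrite !rhoR.
have compH x v : x \in verts H -> connect (wadj H) x v -> v \in verts H.
  move=> xH xv; apply: (connect_stable (P := fun v => v \in verts H)) xv xH _.
  by move=> u w _ /wadjP[a /arc_verts[sH tH] [[_ <-]|[<- _]]].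
have indeg_root x r : r \in R -> indeg (weak_component H x) r = 0.
  move=> rR; apply/eqP; rewrite cards_eq0; apply/eqP/setP=> a; rewrite !inE.
  apply/negP=> /andP[/and3P[aH _ _] /eqP ar].
  by have := branching_tgtNR brH aH; rewrite ar rR.
have treeH r : r \in R -> directed_tree_rooted_at (weak_component H r) r.
  move=> rR; split; last 2 first.
  - by rewrite inE connect0.
  - move=> v; rewrite inE => rv; have [->|nvr] := eqVneq v r.
      by rewrite indeg_root.
    have : v \in verts H by apply: compH rv; apply: RH.
    rewrite vH => /spannedP[vR|[a aH va]].
      by rewrite (root_uniq r v) ?eqxx in nvr.
    apply/cards1P; exists a; apply/setP=> b; rewrite in_set in_set1 in_set !in_set.
    apply/idP/eqP => [/andP[/and3P[bH _ _] /eqP bv]|->].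
      by apply: (branching_tgt_inj brH bH aH); rewrite bv.
    rewrite aH -va rv eqxx !andbT /=; apply: connect_trans rv _.
    by rewrite va symH connect1 // wadj_arc.
  split; last first.
    move=> c; apply/negP=> /and5P[c0 cA cyc cu _].
    apply: branching_acyclic brH c0 _ cyc cu.
    by apply: sub_all cA => s; rewrite !inE => /and3P[].
  split; first by apply/set0Pn; exists r; rewrite inE connect0.
  have symC : connect_sym (wadj (weak_component H r)) by apply/sym_connect_sym/wadj_sym.
  have conC v : connect (wadj H) r v -> connect (wadj (weak_component H r)) r v.
    (* The invariant carries both connections: knowing that both ends of an arc lie in the component
       is what puts the arc in the component. *)
    move=> rv; pose P v := connect (wadj H) r v /\ connect (wadj (weak_component H r)) r v.
    suff [] : P v by [].
    apply: (connect_stable (P := P)) rv _ _; first by split; apply: connect0.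
    move=> u w [ru ru'] uw; have rw := connect_trans ru (connect1 uw).
    split=> //; apply: connect_trans ru' (connect1 _).
    case/wadjP: uw => a aH e; apply/wadjP; exists a => //.
    by rewrite !inE aH; case: e => -[-> ->]; rewrite ru rw.
  by move=> u v; rewrite !inE => /conC ru /conC rv; rewrite (connect_trans _ rv) // symC.
split; last first.
  move=> r; split=> [rR|[x xH [_ + indegC]]]; first by exists r; [apply: RH|apply: treeH].
  (* The element [s] of [R] in this component has in-degree 0, while every vertex other than [r] has
     in-degree 1; hence [s] is [r]. *)
  have [s sR sx] := rootH x xH; have := indegC s.
  rewrite inE symH indeg_root // => /(_ sx) /esym/negbFE/eqP <- //.
exists {r | r \in R}, (fun r => weak_component H (val r)); split.
- by move=> [r rR]; exists r; apply: treeH.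
- move=> [r rR] [s sR]; apply: contraNT => /pred0Pn[v /=]; rewrite !inE => /andP[rv sv].
  by apply/eqP/val_inj/root_uniq => //=; rewrite (connect_trans rv) // symH.
- apply/setP=> v; apply/idP/bigcupP => [/rootH[r rR rv]|[[r rR] _]].
    by exists (exist _ r rR); rewrite // inE.
  by rewrite inE; apply: compH; apply: RH.
- apply/setP=> a; apply/idP/bigcupP => [aH|[r _]]; last by rewrite inE => /andP[].
  have [r rR rs] := rootH _ (arc_verts aH).1.
  exists (exist _ r rR); rewrite // !inE aH rs (connect_trans rs) //.
  exact/connect1/wadj_arc.
Qed.

(** * The transforming sequence *)

(** Induction on the bound [n] for the arcs of [F'] still outside [C]; each round puts one more of
    them into [C] and adds at most one forest. *)
Lemma forest_path n F F' (C : {set Defs.arc G}) :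
    R_directed_forest R F -> R_directed_forest R F' -> branching R C ->
    C \subset arcs F -> C \subset arcs F' -> #|arcs F| = #|arcs F'| ->
    #|arcs F' :\: C| <= n ->
  exists l (Fs : nat -> subgraph G),
    [/\ Fs 0 = F, Fs l = F', forall i, i <= l -> R_directed_forest R (Fs i),
        forall i, i < l ->
          #|arcs (Fs i) :\: arcs (Fs i.+1)| = 1 /\
          #|arcs (Fs i.+1) :\: arcs (Fs i)| = 1
      & l <= n].
Proof.
elim: n F C => [|n IH] F C hF hF' brC sCF sCF' eF le_n;
  have [brF vF] := branching_of_forest hF; have [brF' vF'] := branching_of_forest hF'.
all: have [sF'C|nF'C] := boolP (arcs F' \subset C).
(* If [C] contains all arcs of [F'], so does [F]; equal cardinality gives equal arcs, and these
   determine the vertices, so the sequence has length 0. *)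
1,3: have eA : arcs F = arcs F' by
  [apply/esym/eqP; rewrite eqEcard eF leqnn (subset_trans sF'C)].
1,2: exists 0, (fun=> F); split=> //; apply: subgraph_eq; rewrite // vF vF' eA //.
- by move: le_n; rewrite leqn0 cards_eq0 setD_eq0 (negPf nF'C).
have [B [a [aF' aC brB [braC saCB] eB]]] :=
  branching_exchange brF brF' brC sCF sCF' eF nF'C.
have saCF' : a |: C \subset arcs F' by rewrite subUset sub1set aF'.
have {}le_n : #|arcs F' :\: (a |: C)| <= n.
  rewrite setUC -setDDl -ltnS (leq_trans _ le_n) // [ltnRHS](cardsD1 a).
  by rewrite in_setD aC aF'.
(* When the branching is unchanged no forest is added, so the length may fall short of the bound. *)
case: eB => [eB|[b [aF bF eB]]].
  rewrite eB in saCB; have [l [Fs [? ? ? ? le_l]]] := IH F _ hF hF' braC saCB saCF' eF le_n.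
  by exists l, Fs; split=> //; apply: leqW.
pose F1 := Subgraph (branching_closed brB).
have nab : a != b by apply: contraNneq aF => ->.
have eF1 : #|arcs F1| = #|arcs F'|.
  rewrite -eF /= eB cardsU1 (cardsD1 b (arcs F)) bF in_setD1 nab /= (negPf aF) //.
have [l [Fs [Fs0 Fsl FsF Fsx le_l]]] :=
  IH F1 _ (@forest_of_branching F1 brB erefl) hF' braC saCB saCF' eF1 le_n.
exists l.+1, (fun i => if i is j.+1 then Fs j else F); split=> //.
- by case=> [|i] //; apply: FsF.
- case=> [|i]; last exact: Fsx.
  rewrite Fs0 /= eB; split; apply/eqP/cards1P; [exists b|exists a];
    apply/setP=> c; rewrite !inE.
    have [->|] := eqVneq c b; first by rewrite bF eq_sym (negPf nab).
    by case: (c \in arcs F); rewrite ?andbF ?orbT ?andbT ?orbF.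
  have [->|_] := eqVneq c a; first by rewrite aF.
  by case: (c \in arcs F); rewrite ?andbF.
Qed.

End Forests.

Theorem theorem6 (G : digraph) (R : {set vertex G}) (F F' : subgraph G) (k : nat)
    (hF : R_directed_forest R F) (hF' : R_directed_forest R F')
    (hk : #|arcs F| = k) (hk' : #|arcs F'| = k) :
  exists (l : nat) (Fs : nat -> subgraph G),
    [/\ Fs 0 = F,
        Fs l = F',
        forall i, i <= l -> R_directed_forest R (Fs i),
        forall i, i < l ->
          #|arcs (Fs i) :\: arcs (Fs i.+1)| = 1 /\
          #|arcs (Fs i.+1) :\: arcs (Fs i)| = 1
      & l <= k].
Proof.
(* With the empty branching as initial common part, all [k] arcs of [F'] are outside it. *)
apply: (forest_path hF hF' (branching0 R)); rewrite ?sub0set ?hk ?hk' //.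
by rewrite setD0 hk'.
Qed.
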